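(* The source-free implicit DEC scheme for TE waves is unconditionally stable in the following sense. Let $\varepsilon_0,\mu_0>0$, let $P_1$ be a triangle of the mesh with area $|P_1|>0$, edges $e_1,e_2,e_3$ of lengths $|e_i|>0$ and dual edges of lengths $|\ast e_i|>0$. Let $k\in\mathbb{R}$, and let $\xi\in\mathbb{C}$ and $E_1^n,E_2^n,E_3^n,H_1^n\in\mathbb{C}$, not all of $E_1^n,E_2^n,E_3^n,H_1^n$ being zero, be such that the mode $$E_i^{n+1}=E_i^n\,\xi\quad(i=1,2,3),\qquad H_1^{n+1}=H_1^n\,\xi,\qquad H_{(i)}^{n+1}=H_1^n\cos(k|\ast e_i|)\,\xi\quad(i=1,2,3)$$ satisfies the scheme $$\varepsilon_0\frac{E_i^{n+1}-E_i^n}{\Delta t}=\frac{H_1^{n+1}-H_{(i)}^{n+1}}{|\ast e_i|}\quad(i=1,2,3),\qquad \mu_0\frac{H_1^{n+1}-H_1^n}{\Delta t}=-\frac{E_1^{n+1}|e_1|+E_2^{n+1}|e_2|+E_3^{n+1}|e_3|}{|P_1|}.$$ Then, for every time step $\Delta t>0$ and without any restriction relating $\Delta t$ to the mesh, the growth factor satisfies $|\xi|\le 1$.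
   Context: The implicit DEC scheme is defined on a two-dimensional triangular mesh. $E_i^n$ is the value at time step $n$ of the electric field on the edge $e_i$ of the triangle $P_1$ (edges oriented along the boundary of $P_1$), $H_1^n$ is the value of the magnetizing field on (the dual of) $P_1$, and $H_{(i)}^n$ denotes the value of the magnetizing field on the triangle adjacent to $P_1$ across $e_i$. $\ast e_i$ is the circumcentric dual of $e_i$, of length $|\ast e_i|$. $\varepsilon_0$ and $\mu_0$ are the permittivity and permeability constants, $\Delta t$ is the time step, $k$ is the spatial frequency and $\xi$ is the growth factor in time. Stability means that the growth factor of every nonzero mode of the stated form satisfies $|\xi|\le1$; it is unconditional if this holds for all $\Delta t>0$. *)

(* Defs.v *)
From HB Require Import structures.
From mathcomp Require Import all_boot all_order all_algebra.
From mathcomp Require Import all_classical all_reals all_analysis.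
From mathcomp.real_closed Require Import complex.

Set Implicit Arguments.
Unset Strict Implicit.
Unset Printing Implicit Defensive.

Import Order.TTheory GRing.Theory Num.Theory.

Local Open Scope classical_set_scope.
Local Open Scope ring_scope.
Local Open Scope complex_scope.

Section Geometry.
Variable R : realType.

(* The order of the vertices orients the boundary: the i-th edge runs from
   P i to P (ordS i), where ordS is the cyclic successor on 'I_3. *)
Definition triangle : Type := 'I_3 -> 'rV[R]_2.

(* The library norm on 'rV[R]_2 is the sup norm, hence this definition. *)
Definition dist (p q : 'rV[R]_2) : R :=
  Num.sqrt ((p 0 0 - q 0 0) ^+ 2 + (p 0 1 - q 0 1) ^+ 2).

Definition area (P : triangle) : R :=
  let a := P (inord 0) in let b := P (inord 1) in let c := P (inord 2) in
  `|(b 0 0 - a 0 0) * (c 0 1 - a 0 1) - (c 0 0 - a 0 0) * (b 0 1 - a 0 1)| / 2.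

Definition edge (P : triangle) (i : 'I_3) : 'rV[R]_2 * 'rV[R]_2 :=
  (P i, P (ordS i)).

Definition edge_length (e : 'rV[R]_2 * 'rV[R]_2) : R := dist e.1 e.2.

(* The point is unique when area P is nonzero. *)
Definition circumcenter (P : triangle) : 'rV[R]_2 :=
  xget 0 [set c | forall i j, dist c (P i) = dist c (P j)].

(* The dual of the edge shared by P and Q joins their circumcenters. *)
Definition dual_edge_length (P Q : triangle) : R :=
  dist (circumcenter P) (circumcenter Q).

(* Convex hull of the vertices of P whose index lies in I. *)
Definition face (P : triangle) (I : set 'I_3) : set 'rV[R]_2 :=
  [set x | exists w : 'I_3 -> R,
     [/\ forall i, 0 <= w i, forall i, ~ I i -> w i = 0,
         \sum_i w i = 1 & x = \sum_i w i *: P i]].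

(* Two triangles meet exactly in the face spanned by their common vertices:
   nothing, a vertex, an edge, or the whole triangle. *)
Definition triangular_mesh (M : set triangle) : Prop :=
  (forall P, M P -> 0 < area P) /\
  (forall P Q, M P -> M Q ->
     face P setT `&` face Q setT = face P (P @^-1` range Q)).

Definition adjacent_across (P Q : triangle) (i : 'I_3) : Prop :=
  [/\ range Q <> range P, range Q (P i) & range Q (P (ordS i))].

End Geometry.

Section Scheme.
Variable R : realType.
Variables (E : nat -> 'rV[R]_2 * 'rV[R]_2 -> R[i]) (H : nat -> triangle R -> R[i]).
Variables (P : triangle R) (Q : 'I_3 -> triangle R).

(* Source-free implicit scheme on P for the step from n to n.+1;
   Q i is the triangle adjacent to P across edge P i. *)
Definition implicit_DEC_TE (eps0 mu0 dt : R) (n : nat) : Prop :=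
  (forall i : 'I_3,
     eps0%:C * ((E n.+1 (edge P i) - E n (edge P i)) / dt%:C) =
     (H n.+1 P - H n.+1 (Q i)) / (dual_edge_length P (Q i))%:C) /\
  mu0%:C * ((H n.+1 P - H n P) / dt%:C) =
  - ((\sum_(i < 3) E n.+1 (edge P i) * (edge_length (edge P i))%:C)
     / (area P)%:C).

Definition growth_mode (k : R) (xi : R[i]) (n : nat) : Prop :=
  [/\ forall i : 'I_3, E n.+1 (edge P i) = E n (edge P i) * xi,
      H n.+1 P = H n P * xi &
      forall i : 'I_3,
        H n.+1 (Q i) = H n P * (cos (k * dual_edge_length P (Q i)))%:C * xi].

End Scheme.

(* Main.v *)
(* If the magnetizing field vanishes on P1, a nonzero edge value forces xi = 1.
   Otherwise eliminating the electric field leaves the dispersion relation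
   (xi - 1)^2 = - a xi^2, where a >= 0 because cos <= 1.  Hence
   xi (1 -+ i sqrt a) = 1, and |1 -+ i sqrt a| >= 1. *)
Require Import Defs.
From mathcomp Require Import all_boot all_order all_algebra.
From mathcomp Require Import all_classical all_reals all_analysis.
From mathcomp.real_closed Require Import complex.
From mathcomp Require Import ring.

Import Order.TTheory GRing.Theory Num.Theory.

Local Open Scope classical_set_scope.
Local Open Scope ring_scope.
Local Open Scope complex_scope.

(** For real [s] the squared modulus is [1 + s ^+ 2]. *)
Lemma norm_1Di_ge1 (C : numClosedFieldType) (s : C) :
  s \is Num.real -> 1 <= `|1 + 'i%R * s|.
Proof.
move=> sR; rewrite -(@ler_pXn2r _ 2) ?nnegrE // normC2_rect ?rpred1 //.
by rewrite expr1n lerDl real_exprn_even_ge0.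
Qed.

Lemma norm_le1_of_dispersion (C : numClosedFieldType) (x a : C) :
  0 <= a -> (x - 1) ^+ 2 = - (a * x ^+ 2) -> `|x| <= 1.
Proof.
move=> a_ge0 disp.
have sR : sqrtC a \is Num.real by rewrite ger0_real // sqrtC_ge0.
have bound t : t \is Num.real -> x * (1 + 'i%R * t) = 1 -> `|x| <= 1.
  move=> tR /(congr1 Num.norm); rewrite normrM normr1 => <-.
  by rewrite ler_peMr ?norm_1Di_ge1.
(* The minus sign is absorbed as the square of the imaginary unit, so the relation equates two
   squares and [x - 1] is plus or minus ['i * sqrtC a * x]; [bound] handles each sign with a real
   [t]. *)
have /eqP : (x - 1) ^+ 2 = ('i%R * sqrtC a * x) ^+ 2.
  by rewrite disp !exprMn sqrCi sqrtCK mulN1r mulNr.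
rewrite eqf_sqr => /orP[] /eqP xE.
  apply: (bound (- sqrtC a)); first by rewrite rpredN.
  by rewrite mulrDr mulr1 mulrN mulrN [x * _]mulrC -xE; ring.
apply: (bound (sqrtC a)) => //.
by rewrite mulrDr mulr1 [x * _]mulrC -[X in _ + X]opprK -xE; ring.
Qed.

Theorem mainTheorem3 (R : realType) (eps0 mu0 : R)
    (M : set (triangle R)) (P1 : triangle R) (Q : 'I_3 -> triangle R)
    (E : nat -> 'rV[R]_2 * 'rV[R]_2 -> R[i]) (H : nat -> triangle R -> R[i])
    (n : nat) (k : R) (xi : R[i]) :
  0 < eps0 -> 0 < mu0 ->
  triangular_mesh M -> M P1 ->
  (forall i, M (Q i) /\ adjacent_across P1 (Q i) i) ->
  0 < area P1 ->
  (forall i, 0 < edge_length (edge P1 i)) ->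
  (forall i, 0 < dual_edge_length P1 (Q i)) ->
  (exists i, E n (edge P1 i) != 0) \/ H n P1 != 0 ->
  forall dt : R, 0 < dt ->
  growth_mode E H P1 Q k xi n ->
  implicit_DEC_TE E H P1 Q eps0 mu0 dt n ->
  `|xi| <= 1.
Proof.
move=> eps_gt0 mu_gt0 _ _ _ A_gt0 _ d_gt0 nz dt dt_gt0 [modeE modeH modeHQ].
move=> [schemeE schemeH].
set h := H n P1 in nz modeH modeHQ schemeH.
pose l i := edge_length (edge P1 i).
pose d i := dual_edge_length P1 (Q i).
(* [c] and [g i] are the coupling coefficients left after clearing denominators in the two scheme
   equations; the factor [1 - cos] in [g i] comes from the mode, where the field difference across
   edge [i] is [h * xi * (1 - cos (k * d i))]. *)
pose c := dt / mu0 / area P1.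
pose g i := (1 - cos (k * d i)) / d i * dt / eps0.
have C0 (r : R) : 0 < r -> r%:C != 0 by move=> r0; rewrite fmorph_eq0 gt_eqF.
have [->|xi_neq1] := eqVneq xi 1; first by rewrite normr1.
have EE i : E n (edge P1 i) * (xi - 1) = (g i)%:C * xi * h.
  have := schemeE i; rewrite modeE modeH modeHQ -/h -/(d i) => eqE.
  (* Rebuilds the left-hand side of the scheme, so that [eqE] can replace it. *)
  have -> : E n (edge P1 i) * (xi - 1) =
      eps0%:C * ((E n (edge P1 i) * xi - E n (edge P1 i)) / dt%:C) * dt%:C / eps0%:C.
    by field; rewrite !C0.
  by rewrite eqE /g !(rmorphM, rmorphB, rmorph1, fmorphV) /=; ring.
have HH : h * (xi - 1) =
    - (c)%:C * xi * \sum_(i < 3) E n (edge P1 i) * (l i)%:C.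
  have -> : h * (xi - 1) = mu0%:C * ((h * xi - h) / dt%:C) * dt%:C / mu0%:C.
    by field; rewrite !C0.
  rewrite -modeH schemeH (eq_bigr (fun i => E n (edge P1 i) * (l i)%:C * xi)).
    by rewrite -mulr_suml /c !(rmorphM, fmorphV) /=; ring.
  by move=> i _; rewrite modeE mulrAC.
(* If [h = 0], then [EE] makes every edge value times [xi - 1] vanish; as [xi] differs from 1, the
   whole mode would be zero. *)
have h_neq0 : h != 0.
  case: nz => // -[j]; apply: contraNneq => h0.
  have /eqP := EE j; rewrite h0 mulr0 mulf_eq0 subr_eq0 (negbTE xi_neq1) orbF.
  by move=> ->.
have a_ge0 : 0 <= c * \sum_(i < 3) g i * l i.
  apply: mulr_ge0; first by rewrite !divr_ge0 // ltW.
  apply: sumr_ge0 => i _; apply: mulr_ge0; last exact: sqrtr_ge0.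
  apply: divr_ge0; last exact: ltW.
  apply: mulr_ge0; last exact: ltW.
  by rewrite divr_ge0 ?subr_ge0 ?cos_le1 // ltW ?d_gt0.
apply: (@norm_le1_of_dispersion _ _ (c * \sum_(i < 3) g i * l i)%:C).
  by rewrite ler0c.
(* After multiplying by [h], one factor [xi - 1] is spent on [HH]; the other enters the sum, where
   [EE] turns each edge value into a multiple of [xi * h]. *)
apply: (mulfI h_neq0); rewrite expr2 mulrA HH -[LHS]mulrA mulr_suml.
rewrite (eq_bigr (fun i => (g i * l i)%:C * (xi * h))); last first.
  by move=> i _; rewrite mulrAC EE [(g i * l i)%:C]rmorphM /=; ring.
by rewrite -mulr_suml [(c * _)%:C]rmorphM rmorph_sum /=; ring.
Qed.
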